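(* Let $n>1$ be square-free, let $r,t'\in\mathbb{Z}$ with $\gcd(r,n)=1$, and let $t=\gcd(t',n)$. Then \[\mathsf{c}(\mathrm{D}_{2n}\setminus\{1\},a_{n,r,t'})=\mathsf{c}(U_n,a_{n,r,0})+\mathsf{c}(V_n,a_{n,r,t}),\] where $\mathsf{c}(U_n,a_{n,r,0})=\sum_{d>1,\ d\mid n}\phi(d)/|r|_d$ and \[\mathsf{c}(V_n,a_{n,r,t})=\sum_{(d,\ell)}\frac{d}{\kappa(n,r,t)}\,\phi\!\left(\frac{|r|_n}{\ell\,\gcd\left(\kappa(d,r,t),|r|_n\right)}\right),\] the sum running over pairs of positive integers $(d,\ell)$ with $d\mid n$, $\ell\mid \frac{|r|_n}{\gcd(\kappa(d,r,t),|r|_n)}$ and $\gcd(r^{\ell\kappa(d,r,t)}-1,n)=d$.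
   Context: $\mathrm{D}_{2n}=\langle u_n,v_n\mid u_n^n=1=v_n^2,\ v_nu_nv_n=u_n^{-1}\rangle$. For integers $r,t$ with $\gcd(r,n)=1$, $a_{n,r,t}$ is the automorphism with $u_n^i\mapsto u_n^{ri}$, $u_n^jv_n\mapsto u_n^{rj+t}v_n$. $U_n:=\langle u_n\rangle\setminus\{1\}$, $V_n:=\{u_n^iv_n:0\le i\le n-1\}$. For a set $\Omega$ invariant under an automorphism $a$, $\mathsf{c}(\Omega,a)$ is the number of cycles (including fixed points) of the permutation induced by $a$ on $\Omega$. $|r|_m$ is the multiplicative order of $r$ mod $m$ (with $|r|_1=1$); $S_k(x):=1+x+\cdots+x^{k-1}$, $S_0=0$; $\kappa(m,r,t):=\dfrac{m|r|_m}{\gcd(m,tS_{|r|_m}(r))}$; $\phi$ is Euler's function. *)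

(* Defs.v *)
From mathcomp Require Import all_boot all_order all_algebra.
Set Implicit Arguments.
Unset Strict Implicit.
Unset Printing Implicit Defensive.
Import Order.TTheory GRing.Theory Num.Theory.

Definition squarefree (n : nat) : Prop := forall d : nat, 1 < d -> ~~ (d * d %| n).

(* Concrete model of D_{2n}: (i, false) stands for u_n^i, (i, true) for u_n^i v_n. *)
Definition dihedral (n : nat) : finType := ('I_n * bool)%type.

(* reduce k modulo n, as an element of 'I_n (n > 0 is witnessed by x : 'I_n) *)
Definition ord_mod (n : nat) (x : 'I_n) (k : nat) : 'I_n :=
  Ordinal (ltn_pmod k (leq_ltn_trans (leq0n x) (ltn_ord x))).

Definition zres (n : nat) (z : int) : nat := absz (z %% (n%:Z))%Z.

Definition aut (n : nat) (r t : int) (x : dihedral n) : dihedral n :=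
  let: (i, b) := x in
  if b then (ord_mod i (zres n (r * (i : nat)%:Z + t)), true)
  else (ord_mod i (zres n (r * (i : nat)%:Z)), false).

Arguments aut : clear implicits.

Definition Dnon1 (n : nat) : {set dihedral n} := [set x : dihedral n | x.2 || (nat_of_ord x.1 != 0)].
Definition Uset (n : nat) : {set dihedral n} := [set x : dihedral n | ~~ x.2 && (nat_of_ord x.1 != 0)].
Definition Vset (n : nat) : {set dihedral n} := [set x : dihedral n | x.2].

(* c(Omega, a): number of cycles (orbits, fixed points included) of the map a on Omega,
   via MathComp's fingraph [fcard] (number of connected components of frel a in Omega). *)
Definition ncycles (T : finType) (f : T -> T) (A : {set T}) : nat := fcard f A.

(* |r|_m: multiplicative order of r mod m, i.e. least k >= 1 with r^k = 1 (mod m).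
   For gcd(r,m) = 1 this k is <= m, so searching k in 1..m suffices; |r|_1 = 1. *)
Definition mord (m : nat) (r : int) : nat :=
  (find (fun k => ((r ^+ k.+1)%R == 1 %[mod m%:Z])%Z) (iota 0 m)).+1.

Definition Spoly (k : nat) (x : int) : int := (\sum_(i < k) x ^+ i)%R.

Definition kappa (m : nat) (r t : int) : nat :=
  (m * mord m r) %/ gcdn m (absz (t * Spoly (mord m r) r)%R).

(* Main.v *)
Require Import Defs.
From mathcomp Require Import all_boot all_order all_algebra.
From mathcomp Require Import ring.
From mathcomp Require cyclic.
Import Order.TTheory GRing.Theory Num.Theory.

(* The number of cycles of a permutation is the sum over all points of the inverse
   cycle lengths. A rotation u^i with gcd(i, n) = n/d lies on a cycle of length
   |r|_d, which gives the sum over U_n. On V_n the map is the affine map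
   A : j |-> r j + t modulo n, of order kappa(n, r, t), and Burnside's lemma applies:
   with d = gcd(r^k - 1, n), the iterate A^k has d fixed points if d | t S_k(r),
   i.e. if A^k is the identity modulo d, i.e. if kappa(d, r, t) | k, and none
   otherwise. Sorting the exponents k by d and then by gcd(k, |r|_n) gives the double
   sum, provided that kappa(n, r, t) = lcm(kappa(d, r, t), |r|_n) for the d that
   occur; this is where n squarefree is needed. Finally kappa(d, r, t) depends on t
   only through gcd(t, n), so t' may be replaced by gcd(t', n). *)

(** * Cycle lengths and cycle counts of a permutation *)

Lemma iter_order_dvd (T : finType) (f : T -> T) (x : T) (k : nat) :
  injective f -> (iter k f x == x) = (fingraph.order f x %| k).
Proof.
move=> f_inj; set o := fingraph.order f x.
have fix_mul q : iter (q * o) f x = x.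
  by elim: q => // q IHq; rewrite mulSn iterD IHq iter_order.
rewrite {1}(divn_eq k o) addnC iterD fix_mul eq_sym -(findex_eq0 f) findex_iter //.
by rewrite ltn_pmod // fingraph.order_gt0.
Qed.

(** Grouped by cycle roots: a closed [A] contains whole cycles, and one of length L contributes L
    terms 1/L. *)
Lemma fcard_sum_inv_order (T : finType) (f : T -> T) (A : {set T}) :
  injective f -> fclosed f A ->
  ((fcard f A)%:R = \sum_(x in A) (fingraph.order f x)%:R^-1 :> rat)%R.
Proof.
move=> f_inj clA; have symf := fconnect_sym f_inj.
rewrite (partition_big (froot f) (predI (froots f) (mem A))) /=; last first.
  by move=> x Ax; rewrite roots_root //= -(closed_connect clA (connect_root _ x)).
rewrite /n_comp_mem -sum1_card natr_sum; apply: eq_bigr => x.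
case/andP=> /eqP rootx Ax.
rewrite (eq_bigl (fconnect f x)) => [|y]; last first.
  rewrite -{1}rootx (fingraph.root_connect symf) symf andb_idl // => cxy.
  by rewrite -(closed_connect clA cxy).
rewrite (eq_bigr (fun _ => (fingraph.order f x)%:R^-1)%R) => [|y cxy]; last first.
  congr (_%:R^-1)%R; apply: eq_card => z.
  by rewrite !inE (same_connect symf cxy).
rewrite sumr_const -[#|_|]/(fingraph.order f x) -[RHS]mulr_natl divff //.
by rewrite pnatr_eq0 -lt0n fingraph.order_gt0.
Qed.

(** * Counting residues: multiples, prescribed gcds, linear congruences *)

Lemma sum_multiples (a q : nat) (F : nat -> nat) : 0 < a ->
  \sum_(0 <= k < a * q | a %| k) F k = \sum_(0 <= m < q) F (a * m).
Proof.
move=> a_gt0; elim: q => [|q IHq]; first by rewrite muln0 !big_nil.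
rewrite big_nat_recr //= -IHq mulnS (@big_cat_nat _ _ _ (a * q)) ?leq_addl //=.
congr addn; rewrite big_ltn_cond; last by rewrite -{1}[a * q]add0n ltn_add2r.
rewrite dvdn_mulr // big_nat_cond big1 ?addn0 // => k /andP[/andP[lo hi] dv].
move: dv; rewrite -(subnKC (ltnW lo)) dvdn_addr ?dvdn_mulr // => /dvdn_leq.
rewrite subn_gt0 => /(_ lo); rewrite leqNgt => /negP[].
by rewrite ltn_subLR 1?addnC // ltnW.
Qed.

Lemma sum_gcdn_eq (M l : nat) : 0 < M -> l %| M ->
  \sum_(0 <= m < M) (gcdn m M == l) = totient (M %/ l).
Proof.
move=> M_gt0 lM; have l_gt0 := dvdn_gt0 M_gt0 lM.
have [q Mq] := dvdnP lM; rewrite Mq mulnK // mulnC totient_count_coprime.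
rewrite [RHS](eq_bigr (fun j => (gcdn (l * j) (l * q) == l)%N : nat)) => [|j _]; last first.
  by rewrite -muln_gcdr -[X in _ == X]muln1 eqn_pmul2l // gcdnC.
rewrite -(sum_multiples _ _ (fun k => nat_of_bool (gcdn k (l * q) == l))) //.
rewrite [RHS]big_mkcond /=; apply: eq_bigr => k _.
by case: ifPn => // /negP ndv; case: eqP => // g; case: ndv; rewrite -g dvdn_gcdl.
Qed.

Lemma sum_shift (n s : nat) (F : nat -> nat) : 0 < n ->
  \sum_(j < n) F j = \sum_(j < n) F ((s + j) %% n).
Proof.
case: n => // n _; rewrite (reindex_inj (addrI (inZp s : 'I_n.+1))%R).
by apply: eq_bigr => j _; rewrite /= modnDml.
Qed.

(** With g = gcd(a, n), the condition n | a j amounts to n/g | j. *)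
Lemma sum_dvdz_mul (n : nat) (a : int) : 0 < n ->
  \sum_(j < n) ((n %| (a * j%:Z)%R)%Z : nat) = gcdn (absz a) n.
Proof.
move=> n_gt0; set g := gcdn _ n; have g_gt0 : 0 < g by rewrite gcdn_gt0 n_gt0 orbT.
have gn : g %| n := dvdn_gcdr _ _; have ga : g %| absz a := dvdn_gcdl _ _.
have q_gt0 : 0 < n %/ g by rewrite divn_gt0 // dvdn_leq.
have co : coprime (n %/ g) (absz a %/ g).
  by rewrite /coprime -(eqn_pmul2r g_gt0) muln_gcdl !divnK // gcdnC mul1n.
rewrite -(big_mkord xpredT (fun j => ((n %| (a * j%:Z)%R)%Z : nat))).
rewrite (eq_bigr (fun j => if n %/ g %| j then 1 else 0)) => [|j _]; last first.
  rewrite dvdzE abszM /= -(divnK ga) -{1}(divnK gn) -mulnA (mulnC g) mulnA.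
  by rewrite dvdn_pmul2r // Gauss_dvdr //; case: (_ %| _).
rewrite -big_mkcond -{1}(divnK gn) (sum_multiples _ _ (fun=> 1)) //.
by rewrite sum_nat_const_nat muln1 subn0.
Qed.

Lemma eqmodz_dvd (d x y : int) :
  (x = y %[mod d])%Z -> (d %| x)%Z = (d %| y)%Z.
Proof. by move=> xy; apply/dvdz_mod0P/dvdz_mod0P; rewrite xy. Qed.

Lemma sum_dvdz_affine (n : nat) (a b : int) : 0 < n ->
  \sum_(j < n) ((n %| (a * j%:Z + b)%R)%Z : nat)
    = (gcdn (absz a) n %| b)%Z * gcdn (absz a) n.
Proof.
move=> n_gt0; set g := gcdn _ n.
have gn : (g%:Z %| n%:Z)%Z by rewrite dvdzE dvdn_gcdr.
have ga : (g%:Z %| a)%Z by rewrite dvdzE dvdn_gcdl.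
case: (boolP (_ %| b)%Z) => [gb|ngb]; last first.
  rewrite mul0n big1 // => j _; case: (boolP (_ %| _)%Z) => // nd.
  case/negP: ngb; rewrite -[b](addKr (a * j%:Z)%R) addrC.
  by apply: rpredB; [apply: dvdz_trans gn nd | apply: dvdz_mulr].
have [c bE] := dvdzP gb; have [u [v uv]] := Bezoutz a n.
(* With b = c g and g = u a + v n, the residue s = - c u solves a s + b = 0 modulo n; translating j
   by s leaves the homogeneous congruence. *)
have [s sE] : exists s : nat, (s = - (c * u)%R %[mod n])%Z.
  exists (absz ((- (c * u))%R %% n)%Z).
  by rewrite gez0_abs ?modz_mod // modz_ge0 // -lt0n.
rewrite mul1n /g -(sum_dvdz_mul n a n_gt0).
rewrite (sum_shift n s (fun j => ((n %| (a * j%:Z + b)%R)%Z : nat))) //.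
apply: eq_bigr => j _; congr nat_of_bool; apply: eqmodz_dvd.
have gE : (g%:Z = u * a + v * n)%R by rewrite uv.
rewrite -modz_nat -modzDml modzMmr modzDml PoszD.
have /dvdzP[w sw] : (n%:Z %| (s%:Z + c * u)%R)%Z.
  by rewrite -[(c * u)%R]opprK -eqz_mod_dvd; apply/eqP.
apply/eqP; rewrite eqz_mod_dvd; apply/dvdzP; exists (a * w + c * v)%R.
rewrite mulrDl -(mulrA a w) -sw bE gE.
ring.
Qed.

(** * Multiplicative orders, the sums S_k and the order kappa of an affine map *)

Lemma totient_leq (m : nat) : totient m <= m.
Proof.
rewrite totient_count_coprime -[m in _ <= m]subn0 -[m - 0]muln1.
by rewrite -sum_nat_const_nat leq_sum // => i _; case: coprime.
Qed.

Lemma expz_totient (m : nat) (r : int) : 0 < m -> coprime (absz r) m ->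
  (m%:Z %| (r ^+ totient m - 1)%R)%Z.
Proof.
move=> m_gt0 co; rewrite -eqz_mod_dvd -modzXm.
have r0 : (0 <= (r %% m)%Z)%R by rewrite modz_ge0 // -lt0n.
rewrite -(gez0_abs r0) -rmorphXn /=; apply/eqP.
have coa : coprime (absz (r %% m)%Z) m.
  rewrite /coprime -[gcdn _ _]/(absz (gcdz (r %% m)%Z m%:Z)).
  by rewrite gcdzC gcdz_modr gcdzC.
by rewrite !modz_nat natrXE (cyclic.Euler_exp_totient coa).
Qed.

(** By Euler's theorem the exponent phi(m) <= m lies in the range searched by [mord], so the search
    succeeds; division with remainder does the rest. *)
Lemma mord_dvd (m : nat) (r : int) (k : nat) : 0 < m -> coprime (absz r) m ->
  (mord m r %| k) = (m%:Z %| (r ^+ k - 1)%R)%Z.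
Proof.
move=> m_gt0 co.
have hasm : has (fun k => ((r ^+ k.+1)%R == 1 %[mod m%:Z])%Z) (iota 0 m).
  apply/hasP; exists (totient m).-1.
    by rewrite mem_iota add0n prednK ?totient_gt0 //= totient_leq.
  by rewrite eqz_mod_dvd prednK ?totient_gt0 // expz_totient.
have mordP : ((r ^+ mord m r)%R = 1 %[mod m%:Z])%Z.
  have := nth_find 0 hasm; rewrite nth_iota -?[X in _ < X](size_iota 0 m) -?has_find //.
  by move/eqP.
have mord_min j : 0 < j < mord m r -> ((r ^+ j)%R != 1 %[mod m%:Z])%Z.
  case: j => // j /= jlt; have := before_find 0 jlt; rewrite nth_iota.
    by move->.
  apply: (@leq_trans (mord m r).-1) => //.
  by rewrite -[X in _ <= X](size_iota 0 m) find_size.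
set o := mord m r in mordP mord_min *; have o_gt0 : 0 < o by [].
rewrite -eqz_mod_dvd {2}(divn_eq k o) exprD mulnC exprM -modzMml -modzXm mordP.
rewrite modzXm expr1n modzMml mul1r /dvdn.
case: posnP => [->|k_gt0]; first by rewrite expr0 eqxx.
by apply/esym/negbTE/mord_min; rewrite k_gt0 ltn_pmod.
Qed.

Lemma SpolyD (a b : nat) (x : int) :
  Spoly (a + b) x = (Spoly a x + x ^+ a * Spoly b x)%R.
Proof.
rewrite /Spoly big_split_ord /= mulr_sumr; congr (_ + _)%R.
by apply: eq_bigr => i _; rewrite exprD.
Qed.

Lemma SpolyS (k : nat) (x : int) : Spoly k.+1 x = (x * Spoly k x + 1)%R.
Proof. by rewrite -add1n SpolyD expr1 {1}/Spoly big_ord1 expr0 addrC. Qed.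

Lemma expr_sub1_Spoly (k : nat) (x : int) : (x ^+ k - 1 = (x - 1) * Spoly k x)%R.
Proof. exact: subrX1. Qed.

(** S_{oq}(r) splits into q blocks of o terms, each congruent to S_o(r) because r^o = 1 modulo d. *)
Lemma SpolyM (d o q : nat) (r : int) : (d%:Z %| (r ^+ o - 1)%R)%Z ->
  (Spoly (o * q) r = q%:Z * Spoly o r %[mod d%:Z])%Z.
Proof.
move=> /dvdzP[w ro]; elim: q => [|q IHq]; first by rewrite muln0 mul0r /Spoly big_ord0.
rewrite mulnS SpolyD -modzDmr -modzMmr IHq modzMmr modzDmr.
have -> : (r ^+ o = w * d%:Z + 1)%R by rewrite -ro subrK.
apply/eqP; rewrite eqz_mod_dvd; apply/dvdzP; exists (w * q%:Z * Spoly o r)%R.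
rewrite -addn1 PoszD; ring.
Qed.

Lemma kappa_gt0 (d : nat) (r t : int) : 0 < d -> 0 < kappa d r t.
Proof.
move=> d_gt0; rewrite divn_gt0 ?gcdn_gt0 ?d_gt0 // dvdn_leq ?muln_gt0 ?d_gt0 //.
by apply: dvdn_mulr; apply: dvdn_gcdl.
Qed.

(* The right-hand side says that the k-th iterate of j |-> r j + t is the
   identity modulo d, so kappa is the order of this affine map. *)
Lemma kappa_dvd (d : nat) (r t : int) (k : nat) : 0 < d -> coprime (absz r) d ->
  (kappa d r t %| k)
    = (d%:Z %| (r ^+ k - 1)%R)%Z && (d%:Z %| (t * Spoly k r)%R)%Z.
Proof.
move=> d_gt0 co; rewrite -mord_dvd // /kappa; set o := mord d r; set g := gcdn d _.
have gd : g %| d by apply: dvdn_gcdl.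
have g_gt0 : 0 < g by apply: dvdn_gt0 gd.
have q_gt0 : 0 < d %/ g by rewrite divn_gt0 // dvdn_leq.
have o_gt0 : 0 < o by [].
rewrite mulnC -muln_divA //.
case: (boolP (o %| k)) => [/dvdnP[q ->]|nok] /=; last first.
  by apply/negbTE; apply: contra nok; apply: dvdn_trans; apply: dvdn_mulr.
rewrite mulnC dvdn_pmul2r // [q * o]mulnC.
have dro : (d%:Z %| (r ^+ o - 1)%R)%Z by rewrite -mord_dvd.
(* Modulo d, t S_{oq}(r) becomes q t S_o(r); as g = gcd(d, t S_o(r)), d divides it exactly when d/g
   divides q. *)
rewrite -(@eqmodz_dvd d (q%:Z * (t * Spoly o r))%R); last first.
  by rewrite -[RHS]modzMmr (SpolyM _ _ q _ dro) modzMmr mulrCA.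
rewrite dvdzE abszM /=; set x := absz _.
have gx : g %| x by apply: dvdn_gcdr.
rewrite -[X in X %| _ * _](divnK gd) -(divnK gx) mulnA dvdn_pmul2r // mulnC Gauss_dvdr //.
by rewrite /coprime -(eqn_pmul2r g_gt0) muln_gcdl !divnK // mul1n.
Qed.

(** For d | n, gcd(d, gcd(t, n) S) = gcd(d, t S, n S) = gcd(d, t S). *)
Lemma kappa_gcd (n d : nat) (r t : int) : d %| n ->
  kappa d r (Posz (gcdn (absz t) n)) = kappa d r t.
Proof.
move=> dn; congr (_ %/ _); rewrite !abszM /=; set S := absz _.
apply/eqP; rewrite eqn_dvd !dvdn_gcd !dvdn_gcdl /=; apply/andP; split.
  by rewrite (dvdn_trans (dvdn_gcdr _ _)) // dvdn_mul // dvdn_gcdl.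
rewrite muln_gcdl dvdn_gcd dvdn_gcdr /= (dvdn_trans (dvdn_gcdl _ _)) //.
exact: dvdn_mulr.
Qed.

(** * Square-free moduli and the gcd of r^k - 1 with n *)

Lemma squarefree_coprime_div (n e : nat) : squarefree n -> 0 < n -> e %| n ->
  coprime e (n %/ e).
Proof.
move=> sqf n_gt0 en; have n_eq := divnK en.
rewrite /coprime eqn_leq gcdn_gt0 (dvdn_gt0 n_gt0 en) andbT leqNgt.
apply/negP => /sqf/negP[]; rewrite -[X in _ %| X]n_eq.
by rewrite dvdn_mul ?dvdn_gcdl ?dvdn_gcdr.
Qed.

(** The number of fixed points of j |-> r^k j modulo n. *)
Definition fixmod (n : nat) (r : int) (k : nat) := gcdn (absz (r ^+ k - 1)%R) n.

(** A divisor e of n divides r^k - 1 iff |r|_e | k, and |r|_e divides |r|_n; so k and gcd(k, |r|_n)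
    admit the same e. *)
Lemma fixmod_gcd (n : nat) (r : int) (k : nat) : 0 < n -> coprime (absz r) n ->
  fixmod n r k = fixmod n r (gcdn k (mord n r)).
Proof.
move=> n_gt0 co.
have dvdE e j : e %| n -> (e %| absz (r ^+ j - 1)%R) = (mord e r %| j).
  move=> en; rewrite mord_dvd ?(dvdn_gt0 n_gt0 en) ?dvdzE //.
  exact: coprime_dvdr en co.
have mordn e : e %| n -> mord e r %| mord n r.
  move=> en; rewrite -dvdE //; apply: dvdn_trans en _.
  by rewrite dvdE.
have sub e j j' : (mord e r %| mord n r -> mord e r %| j -> mord e r %| j') ->
  e %| fixmod n r j -> e %| fixmod n r j'.
  move=> h; rewrite !dvdn_gcd => /andP[h1 en]; move: h1.
  by rewrite en !dvdE // andbT; apply: h; apply: mordn.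
apply/eqP; rewrite eqn_dvd; apply/andP; split; apply: sub (dvdnn _).
  by move=> h1 h2; rewrite dvdn_gcd h2.
by move=> _; rewrite dvdn_gcd => /andP[].
Qed.

(* Modulo d the map j |-> r j + t already has trivial K-th iterate. With
   e = gcd(r - 1, n), the factor e divides d, while n / e divides S_K(r) since
   n | r^K - 1 = (r - 1) S_K(r); squarefreeness makes e and n / e coprime. *)
Lemma kappa_lcm (n d k : nat) (r t : int) :
  squarefree n -> 0 < n -> coprime (absz r) n -> d %| n ->
  kappa d r t %| k -> fixmod n r k = d ->
  kappa n r t = lcmn (kappa d r t) (mord n r).
Proof.
move=> sqf n_gt0 co dn kd fk.
have d_gt0 := dvdn_gt0 n_gt0 dn; have cod := coprime_dvdr dn co.
apply/eqP; rewrite eqn_dvd; apply/andP; split; last first.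
  have := dvdnn (kappa n r t); rewrite {1}kappa_dvd // => /andP[nr nt].
  rewrite dvdn_lcm kappa_dvd // mord_dvd // nr andbT.
  by apply/andP; split; apply: (@dvdz_trans n%:Z) => //; rewrite dvdzE.
set K := lcmn _ _.
have nK : (n%:Z %| (r ^+ K - 1)%R)%Z by rewrite -mord_dvd // dvdn_lcmr.
have : kappa d r t %| K by apply: dvdn_lcml.
rewrite !kappa_dvd // nK => /andP[_ dK] /=.
pose e := gcdn (absz (r - 1)%R) n.
have en : e %| n by apply: dvdn_gcdr.
have ed : e %| d.
  rewrite -fk /fixmod dvdn_gcd en andbT expr_sub1_Spoly abszM dvdn_mulr //.
  exact: dvdn_gcdl.
have e_gt0 := dvdn_gt0 n_gt0 en.
rewrite dvdzE /= -(divnK en) Gauss_dvd 1?coprime_sym ?squarefree_coprime_div //.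
rewrite [X in _ && X](dvdn_trans ed) ?andbT; last by rewrite dvdzE in dK.
rewrite abszM dvdn_mull //.
move: nK; rewrite dvdzE expr_sub1_Spoly abszM /=.
(* As e = gcd(r - 1, n), the quotients n/e and (r - 1)/e are coprime, so cancelling e leaves n/e |
   S_K(r). *)
have er : e %| absz (r - 1)%R by apply: dvdn_gcdl.
rewrite -[X in X %| _](divnK en) -{1}(divnK er) mulnAC dvdn_pmul2r // Gauss_dvdr //.
by rewrite /coprime -(eqn_pmul2r e_gt0) muln_gcdl !divnK // gcdnC mul1n.
Qed.

(** * Burnside's lemma for the iterates of one permutation *)

(** A point on a cycle of length o is fixed by K/o of the exponents k < K, and summing 1/o over [A]
    counts the cycles. *)
Lemma burnside_iter (T : finType) (f : T -> T) (A : {set T}) (K : nat) :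
  injective f -> fclosed f A -> 0 < K -> {in A, forall x, iter K f x = x} ->
  K * fcard f A = \sum_(0 <= k < K) \sum_(x in A) (iter k f x == x).
Proof.
move=> f_inj clA K_gt0 fixK; apply/eqP; rewrite -(eqr_nat rat) natrM.
rewrite (fcard_sum_inv_order _ _ _ f_inj clA) mulr_sumr exchange_big natr_sum /=.
apply/eqP/eq_bigr => x Ax; set o := fingraph.order f x.
have o_gt0 : 0 < o by apply: fingraph.order_gt0.
have /dvdnP[q Kq] : o %| K by rewrite -iter_order_dvd // fixK.
rewrite (eq_bigr (fun k => if o %| k then 1 else 0)) => [|k _]; last first.
  by rewrite iter_order_dvd // -/o; case: (_ %| _).
rewrite -big_mkcond Kq mulnC (sum_multiples _ _ (fun=> 1)) // sum_nat_const_nat.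
by rewrite subn0 muln1 natrM mulrC mulKf // pnatr_eq0 -lt0n.
Qed.

(** * Iterates of the automorphism and its invariant sets *)

Lemma ord_modE (n : nat) (i : 'I_n) (z : int) :
  ((ord_mod i (zres n z) : nat)%:Z = z %% n%:Z)%Z.
Proof.
have n_gt0 : 0 < n by apply: leq_ltn_trans (ltn_ord i).
by rewrite /= -modz_nat gez0_abs ?modz_mod // modz_ge0 // -lt0n.
Qed.

(** The term [t *+ x.2] is t on reflections and 0 on rotations, so one formula covers both. *)
Lemma iter_autE (n : nat) (r t : int) (k : nat) (x : dihedral n) :
  (iter k (aut n r t) x).2 = x.2 /\
  ((iter k (aut n r t) x).1%:Z
     = r ^+ k * x.1%:Z + t *+ x.2 * Spoly k r %[mod n%:Z])%Z.
Proof.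
elim: k => [|k [IH2 IH1]] /=.
  by split=> //; rewrite /Spoly big_ord0 mulr0 addr0 mul1r.
case: (iter k _ x) IH1 IH2 => j b /= IH1 ->.
have -> : (r ^+ k.+1 * x.1%:Z + t *+ x.2 * Spoly k.+1 r
           = r * (r ^+ k * x.1%:Z + t *+ x.2 * Spoly k r) + t *+ x.2)%R.
  rewrite SpolyS exprS; ring.
have -> : (r * (r ^+ k * x.1%:Z + t *+ x.2 * Spoly k r) + t *+ x.2
           = r * j%:Z + t *+ x.2 %[mod n%:Z])%Z.
  by rewrite -[LHS]modzDml -(modzMmr r) -IH1 modzMmr modzDml.
by case: (x.2); split=> //; rewrite ord_modE modz_mod ?mulr1n ?mulr0n ?addr0.
Qed.

Lemma iter_aut_fix (n : nat) (r t : int) (k : nat) (x : dihedral n) :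
  (iter k (aut n r t) x == x)
    = (n%:Z %| ((r ^+ k - 1) * x.1%:Z + t *+ x.2 * Spoly k r)%R)%Z.
Proof.
have [E2 E1] := iter_autE n r t k x.
rewrite -pair_eqE /pair_eq /= E2 eqxx andbT mulrBl mul1r addrAC -eqz_mod_dvd -E1.
by rewrite !modz_nat eqz_nat !modn_small.
Qed.

Lemma aut_inj (n : nat) (r t : int) :
  coprime (absz r) n -> injective (aut n r t).
Proof.
move=> co x y exy; have [X2 X1] := iter_autE n r t 1 x.
have [Y2 Y1] := iter_autE n r t 1 y; move: X2 X1; rewrite /= exy.
rewrite Y2 Y1 => E2; rewrite E2 !expr1 => /eqP; rewrite eqz_modDr eqz_mod_dvd.
rewrite -mulrBr Gauss_dvdzr /coprimez; last by rewrite /gcdz gcdnC.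
rewrite -eqz_mod_dvd !modz_nat eqz_nat !modn_small //.
by case: x y E2 {exy Y2 Y1} => [i b] [j c] /= -> /eqP/ord_inj->.
Qed.

Lemma aut_fst_neq0 (n : nat) (r t : int) (x : dihedral n) :
  coprime (absz r) n -> ~~ x.2 ->
  ((aut n r t x).1 != 0 :> nat) = (x.1 != 0 :> nat).
Proof.
move=> co x2; congr (~~ _); have [_] := iter_autE n r t 1 x.
rewrite (negbTE x2) mulr0n mul0r addr0 expr1 /= => E.
have lt0 (i : 'I_n) : (nat_of_ord i == 0) = (n%:Z %| i%:Z)%Z.
  by rewrite dvdzE /= /dvdn modn_small.
by rewrite !lt0 (eqmodz_dvd _ _ _ E) Gauss_dvdzr // /coprimez /gcdz gcdnC.
Qed.

Lemma aut_snd (n : nat) (r t : int) (x : dihedral n) : (aut n r t x).2 = x.2.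
Proof. by case: x => i []. Qed.

Lemma Vset_closed (n : nat) (r t : int) : fclosed (aut n r t) (Vset n).
Proof. by move=> x _ /eqP <-; rewrite !inE aut_snd. Qed.

Lemma Uset_closed (n : nat) (r t : int) :
  coprime (absz r) n -> fclosed (aut n r t) (Uset n).
Proof.
move=> co x _ /eqP <-; rewrite !inE aut_snd.
by case: (boolP x.2) => //= x2; rewrite aut_fst_neq0.
Qed.

Lemma ncycles_Dnon1 (n : nat) (r t : int) : coprime (absz r) n ->
  ncycles (aut n r t) (Dnon1 n)
    = ncycles (aut n r t) (Uset n) + ncycles (aut n r t) (Vset n).
Proof.
move=> co; rewrite /ncycles /n_comp_mem -cardUI [X in _ = _ + X]eq_card0 ?addn0.
  by apply: eq_card => -[i b]; rewrite !inE /=; case: (roots _ _); case: b; rewrite ?orbF.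
by move=> -[i []]; rewrite !inE /= ?andbF.
Qed.

(** * Cycles on the rotations *)

Lemma order_aut_rot (n : nat) (r t : int) (x : dihedral n) :
  coprime (absz r) n -> ~~ x.2 ->
  fingraph.order (aut n r t) x = mord (n %/ gcdn x.1 n) r.
Proof.
move=> co x2; have n_gt0 : 0 < n by apply: leq_ltn_trans (ltn_ord x.1).
set g := gcdn _ _; have gn : g %| n by apply: dvdn_gcdr.
have g_gt0 : 0 < g by apply: dvdn_gt0 gn.
have q_gt0 : 0 < n %/ g by rewrite divn_gt0 // dvdn_leq.
have coq : coprime (absz r) (n %/ g) by apply: coprime_dvdr co; apply: dvdn_div.
suff ok k : (fingraph.order (aut n r t) x %| k) = (mord (n %/ g) r %| k).
  by apply/eqP; rewrite eqn_dvd ok dvdnn -ok dvdnn.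
rewrite -iter_order_dvd; last exact: aut_inj.
rewrite iter_aut_fix (negbTE x2) mulr0n mul0r addr0 mord_dvd // !dvdzE abszM /=.
have gx : g %| x.1 by apply: dvdn_gcdl.
rewrite -{1}(divnK gn) -(divnK gx) mulnA dvdn_pmul2r // mulnC Gauss_dvdr //.
by rewrite /coprime -(eqn_pmul2r g_gt0) muln_gcdl !divnK // gcdnC mul1n.
Qed.

(** Read from right to left, this inserts a sum over divisors, so that terms can be sorted by a
    divisor attached to them. *)
Lemma sum_divisors_pick (n d : nat) (R : nmodType) (F : nat -> R) :
  0 < n -> d %| n -> (\sum_(e <- divisors n | d == e) F e = F d)%R.
Proof.
move=> n_gt0 dn; rewrite big_mkcond (bigD1_seq d) ?divisors_uniq //=; last first.
  by rewrite -dvdn_divisors.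
by rewrite eqxx big1 ?addr0 // => e; rewrite eq_sym => /negbTE->.
Qed.

Lemma ncycles_Uset (n : nat) (r t : int) : 0 < n -> coprime (absz r) n ->
  ((ncycles (aut n r t) (Uset n))%:R
    = \sum_(d <- divisors n | (1 < d)%N) (totient d)%:R / (mord d r)%:R :> rat)%R.
Proof.
move=> n_gt0 co.
rewrite /ncycles fcard_sum_inv_order; [|exact: aut_inj|exact: Uset_closed].
rewrite (eq_bigr (fun x : dihedral n => \sum_(d <- divisors n)
  ((n %/ gcdn x.1 n)%N == d)%:R * (mord d r)%:R^-1)%R); last first.
  move=> x; rewrite inE => /andP[x2 _]; rewrite order_aut_rot //.
  rewrite -(sum_divisors_pick n _ _ (fun e => (mord e r)%:R^-1)%R n_gt0); last first.
    by rewrite dvdn_div // dvdn_gcdr.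
  by rewrite big_mkcond; apply: eq_bigr => d _; case: eqP; rewrite ?mul1r ?mul0r.
rewrite exchange_big [RHS]big_mkcond /= big_seq [RHS]big_seq; apply: eq_bigr => d.
rewrite -dvdn_divisors // => dn; have d_gt0 := dvdn_gt0 n_gt0 dn.
rewrite -mulr_suml -natr_sum.
rewrite (eq_bigl (fun x : dihedral n => ((x.1 : nat) != 0) && (x.2 == false))); last first.
  by move=> -[i []]; rewrite !inE /= ?andbF ?andbT.
rewrite -(pair_big (fun i : 'I_n => (i : nat) != 0) (pred1 false)
  (fun i _ => (n %/ gcdn i n == d) : nat)) /=.
under eq_bigr do rewrite big_pred1_eq.
have gE (i : 'I_n) : (n %/ gcdn i n == d) = (gcdn i n == n %/ d).
  have gn : gcdn i n %| n by apply: dvdn_gcdr.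
  have g_gt0 : 0 < gcdn i n by apply: dvdn_gt0 gn.
  by rewrite eq_sym !eqn_div // mulnC.
rewrite (eq_bigr (fun i : 'I_n => (gcdn i n == n %/ d) : nat)) => [|i _]; last by rewrite gE.
(* For d > 1 the index 0, absent from [Uset], fails gcd(i, n) = n/d and may be added to the sum; for
   d = 1 it is the only solution, so nothing remains. *)
case: ltnP => [d_gt1|d_le1].
  congr (_%:R / _)%R.
  have -> : totient d = \sum_(i < n) (gcdn i n == n %/ d).
    rewrite -(big_mkord xpredT (fun i => (gcdn i n == n %/ d) : nat)).
    by rewrite sum_gcdn_eq ?dvdn_div // divnA // mulKn.
  rewrite [LHS]big_mkcond; apply: eq_bigr => i _ /=.
  case: eqP => //= ->; rewrite gcd0n; case: eqP => // nd.
  by have := ltn_Pdiv d_gt1 n_gt0; rewrite -nd ltnn.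
have -> : d = 1 by apply/eqP; rewrite eqn_leq d_le1.
rewrite big1 ?mul0r // => i i0; rewrite divn1; case: eqP => // gin.
have := dvdn_gcdl i n; rewrite gin => /dvdn_leq; rewrite lt0n i0 => /(_ isT).
by rewrite leqNgt ltn_ord.
Qed.

(** * Cycles on the reflections *)

Lemma ncycles_Vset_kappa (n : nat) (r t : int) : 0 < n -> coprime (absz r) n ->
  kappa n r t * ncycles (aut n r t) (Vset n)
    = \sum_(0 <= k < kappa n r t)
        (kappa (fixmod n r k) r t %| k) * fixmod n r k.
Proof.
move=> n_gt0 co; have := dvdnn (kappa n r t); rewrite {1}kappa_dvd // => /andP[nr nt].
rewrite burnside_iter ?kappa_gt0 //; first last.
- move=> x; rewrite inE => x2; apply/eqP; rewrite iter_aut_fix x2 mulr1n.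
  by apply: rpredD => //; apply: dvdz_mulr.
- exact: Vset_closed.
- exact: aut_inj.
apply: eq_bigr => k _.
rewrite (eq_big (fun x : dihedral n => xpredT x.1 && pred1 true x.2)
  (fun x : dihedral n => (iter k (aut n r t) (x.1, x.2) == (x.1, x.2)) : nat)).
- rewrite -(pair_big xpredT (pred1 true)
    (fun i b => (iter k (aut n r t) (i, b) == (i, b)) : nat)) /=.
  under eq_bigr do rewrite big_pred1_eq iter_aut_fix /= mulr1n.
  rewrite sum_dvdz_affine //; congr (nat_of_bool _ * _).
  (* The solvability condition is d | t S_k(r) with d = [fixmod n r k]; since d | r^k - 1 by
     construction, it is equivalent to kappa(d, r, t) | k. *)
  have gn : fixmod n r k %| n by apply: dvdn_gcdr.
  rewrite -/(fixmod n r k) kappa_dvd ?(dvdn_gt0 n_gt0 gn) ?(coprime_dvdr gn) //.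
  by rewrite [X in X && _](_ : _ = true) // dvdzE dvdn_gcdl.
- by move=> -[i []]; rewrite inE.
- by case.
Qed.

Lemma sum_fixmod_eq (n d q : nat) (r : int) (M := mord n r %/ gcdn q (mord n r)) :
  0 < n -> coprime (absz r) n ->
  \sum_(0 <= m < M) (fixmod n r (q * m) == d)
    = \sum_(l <- divisors M | fixmod n r (l * q) == d) totient (M %/ l).
Proof.
move=> n_gt0 co; set o := mord n r in M *; set c := gcdn q o in M *.
have o_gt0 : 0 < o by [].
have cq : c %| q by apply: dvdn_gcdl.
have cM : M * c = o by rewrite divnK // dvdn_gcdr.
have c_gt0 : 0 < c by rewrite gcdn_gt0 o_gt0 orbT.
have M_gt0 : 0 < M by move: o_gt0; rewrite -cM muln_gt0 => /andP[].
have coM : coprime M (q %/ c).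
  by rewrite /coprime -(eqn_pmul2r c_gt0) muln_gcdl cM divnK // gcdnC mul1n.
(* Since q/c is coprime to M = o/c, gcd(q m, o) = c gcd(m, M): only l = gcd(m, M) matters. *)
have fixE m : fixmod n r (q * m) = fixmod n r (q * gcdn m M).
  rewrite fixmod_gcd // [RHS]fixmod_gcd //; congr fixmod; rewrite -/o.
  rewrite -{1 2}(divnK cq) -cM -!(mulnAC _ _ c) -!muln_gcdl.
  rewrite !(gcdnC _ M) !Gauss_gcdr //. by rewrite gcdnA gcdnn.
rewrite (eq_bigr (fun m => \sum_(l <- divisors M)
   (fixmod n r (l * q) == d) * (gcdn m M == l))) => [|m _]; last first.
  rewrite fixE mulnC -(sum_divisors_pick M (gcdn m M) nat
    (fun l => (fixmod n r (l * q) == d) : nat)) ?dvdn_gcdr //.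
  by rewrite big_mkcond; apply: eq_bigr => l _; case: (gcdn m M == l); rewrite ?muln1 ?muln0.
rewrite exchange_big [RHS]big_mkcond /= big_seq [RHS]big_seq; apply: eq_bigr => l.
rewrite -dvdn_divisors // => lM; rewrite -big_distrr /= sum_gcdn_eq //.
by case: ifP; rewrite ?mul1n ?mul0n.
Qed.

Lemma sum_fixmod_kappa (n d : nat) (r t : int)
    (M := mord n r %/ gcdn (kappa d r t) (mord n r)) :
  squarefree n -> 0 < n -> coprime (absz r) n -> d %| n ->
  \sum_(0 <= k < kappa n r t | kappa d r t %| k) (fixmod n r k == d)
    = \sum_(l <- divisors M | fixmod n r (l * kappa d r t) == d) totient (M %/ l).
Proof.
move=> sqf n_gt0 co dn; rewrite -sum_fixmod_eq // -/M.
have d_gt0 := dvdn_gt0 n_gt0 dn.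
(* If d occurs for some k, [kappa_lcm] gives kappa(n, r, t) = kappa(d, r, t) M; if not, both sides
   vanish. The bound on k exceeds all exponents on either side. *)
have [/existsP[k /andP[kd /eqP fk]]|none] := boolP
  [exists k : 'I_(kappa n r t * (kappa d r t * M).+1), (kappa d r t %| k) && (fixmod n r k == d)].
  have -> : kappa n r t = kappa d r t * M.
    rewrite (kappa_lcm n d k) // /lcmn /M muln_divA //; exact: dvdn_gcdr.
  by rewrite (sum_multiples _ _ (fun k => (fixmod n r k == d) : nat)) // kappa_gt0.
rewrite negb_exists in none.
have no k : k < kappa n r t * (kappa d r t * M).+1 -> kappa d r t %| k -> fixmod n r k != d.
  by move=> lt kd; move/forallP/(_ (Ordinal lt)): none; rewrite /= kd.
rewrite [LHS]big_nat_cond [RHS]big_nat_cond !big1 // => [m|k] /andP[/andP[_ lt]].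
  move=> _; rewrite (negbTE (no _ _ _)) ?dvdn_mulr //.
  apply: (@leq_trans (kappa d r t * M).+1); last by rewrite leq_pmull ?kappa_gt0.
  by rewrite ltnS leq_mul // ltnW.
by move=> kd; rewrite (negbTE (no _ _ kd)) // (leq_trans lt) // leq_pmulr.
Qed.

Lemma ncycles_Vset (n : nat) (r t : int) :
  squarefree n -> 0 < n -> coprime (absz r) n ->
  ((ncycles (aut n r t) (Vset n))%:R
    = \sum_(d <- divisors n)
        \sum_(l <- divisors (mord n r %/ gcdn (kappa d r t) (mord n r))%N
              | fixmod n r (l * kappa d r t) == d)
          d%:R / (kappa n r t)%:R
            * (totient (mord n r %/ (l * gcdn (kappa d r t) (mord n r)))%N)%:R
    :> rat)%R.
Proof.
move=> sqf n_gt0 co.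
have k0 : ((kappa n r t)%:R != 0 :> rat)%R by rewrite pnatr_eq0 -lt0n kappa_gt0.
apply: (mulfI k0); rewrite -natrM ncycles_Vset_kappa //.
(* Sort the exponents k by the value d of [fixmod n r k]. *)
rewrite (eq_bigr (fun k => \sum_(d <- divisors n)
   d * ((kappa d r t %| k) * (fixmod n r k == d)))) => [|k _]; last first.
  rewrite -(sum_divisors_pick n (fixmod n r k) nat
    (fun d => (kappa d r t %| k) * d)) ?dvdn_gcdr //.
  rewrite big_mkcond; apply: eq_bigr => d _; case: (fixmod n r k == d).
    by rewrite muln1 mulnC.
  by rewrite !muln0.
rewrite exchange_big natr_sum mulr_sumr /= big_seq [RHS]big_seq.
apply: eq_bigr => d; rewrite -dvdn_divisors // => dn.
rewrite -big_distrr /= (eq_bigr (fun k => if kappa d r t %| k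
  then (fixmod n r k == d) : nat else 0)) => [|k _]; last first.
  by case: ifP; rewrite ?mul1n ?mul0n.
rewrite -big_mkcond /= sum_fixmod_kappa // natrM natr_sum !mulr_sumr.
apply: eq_bigr => l _; rewrite [l * _]mulnC divnMA.
by rewrite mulrA [(_ * (d%:R / _))%R]mulrC mulfVK.
Qed.

(** * Assembly, with the translation t' replaced by 0 and by gcd(t', n) *)

Theorem theorem4p4 (n : nat) (r t' : int) :
  1 < n -> squarefree n -> coprime (absz r) n ->
  let t : nat := gcdn (absz t') n in
  [/\ ncycles (aut n r t') (Dnon1 n)
        = ncycles (aut n r 0) (Uset n) + ncycles (aut n r (Posz t)) (Vset n),
      ((ncycles (aut n r 0) (Uset n))%:R
        = \sum_(d <- divisors n | (1 < d)%N) (totient d)%:R / (mord d r)%:R :> rat)%R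
    & ((ncycles (aut n r (Posz t)) (Vset n))%:R
        = \sum_(d <- divisors n)
             \sum_(l <- divisors (mord n r %/ gcdn (kappa d r (Posz t)) (mord n r))%N
                   | gcdn (absz (r ^+ (l * kappa d r (Posz t))%N - 1)) n == d)
               d%:R / (kappa n r (Posz t))%:R
                 * (totient (mord n r %/ (l * gcdn (kappa d r (Posz t)) (mord n r)))%N)%:R
           :> rat)%R].
Proof.
move=> /ltnW n_gt0 sqf co t; split; [|exact: ncycles_Uset|exact: ncycles_Vset].
have natQ_inj (a b : nat) : (a%:R = b%:R :> rat)%R -> a = b.
  by move/eqP; rewrite eqr_nat => /eqP.
(* The formula on rotations does not involve the translation. *)
have rotE : ncycles (aut n r t') (Uset n) = ncycles (aut n r 0) (Uset n).
  apply: natQ_inj.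
  exact: etrans (ncycles_Uset n r t' n_gt0 co) (esym (ncycles_Uset n r 0 n_gt0 co)).
(* Here the translation enters only through kappa(d, r, t') with d | n, where [kappa_gcd]
   applies. *)
have reflE : ncycles (aut n r t') (Vset n) = ncycles (aut n r (Posz t)) (Vset n).
  apply: natQ_inj.
  apply: etrans (ncycles_Vset n r t' sqf n_gt0 co) _.
  apply: etrans _ (esym (ncycles_Vset n r (Posz t) sqf n_gt0 co)).
  rewrite big_seq [RHS]big_seq; apply: eq_bigr => d.
  rewrite -(dvdn_divisors _ n_gt0) => dn.
  by rewrite !(kappa_gcd _ _ _ _ dn) !(kappa_gcd _ _ _ _ (dvdnn n)).
refine (etrans (ncycles_Dnon1 n r t' co) _).
exact (f_equal2 addn rotE reflE).
Qed.
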